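(* Let $\mathscr A,\mathscr B$ be unital $C^*$-algebras, $\mathcal H$ a Hilbert space, and let $\Omega:\mathscr B\to B(\mathcal H)$ and $\Lambda:\mathscr A\to\mathscr B$ be completely positive maps. Let $(\pi,\mathcal K_\Omega,V)$ be a minimal Stinespring representation of $\Omega$ and $(\varphi,\mathcal L,S)$ a minimal Stinespring representation of $\pi\circ\Lambda$. Let $\mathcal K_{\Omega,\Lambda}$, $Q_{\Omega,\Lambda}$, $\Gamma_\Lambda^\Omega$ and $\mathcal T_\Lambda^\Omega$ be as defined in the context. Then for every $D\in\pi(\mathscr B)'$, $$\mathcal T_\Lambda^\Omega(D)=Q_{\Omega,\Lambda}\,\Gamma_\Lambda^\Omega(D)\,Q_{\Omega,\Lambda}\big|_{\mathcal K_{\Omega,\Lambda}}.$$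
   Context: For completely positive maps, $\Phi\le\Psi$ means $\Psi-\Phi$ is completely positive. A Stinespring representation of a completely positive map $\Psi:\mathscr C\to B(\mathcal G)$ is a triple $(\sigma,\mathcal K,T)$ with $\sigma:\mathscr C\to B(\mathcal K)$ a unital $*$-representation, $T:\mathcal G\to\mathcal K$ bounded and $\Psi(C)=T^*\sigma(C)T$; it is minimal if $\mathcal K=\overline{\operatorname{span}}\{\sigma(C)T\xi\}$. Radon--Nikodym theorem (known): if $(\sigma,\mathcal K,T)$ is minimal and $\Phi$ is completely positive with $\Phi\le c\Psi$ for some $c\ge0$, there is a unique positive $E\in\sigma(\mathscr C)'$ with $\Phi(C)=T^*\sigma(C)ET$ for all $C$; it is denoted $\frac{\mathrm d\Phi}{\mathrm d\Psi}$. Setting: $\Omega(B)=V^*\pi(B)V$ and $\pi(\Lambda(A))=S^*\varphi(A)S$ are the minimal Stinespring representations on $\mathcal K_\Omega$ and $\mathcal L$. Put $\mathcal K_{\Omega,\Lambda}=\overline{\operatorname{span}}\{\varphi(A)SV\xi:A\in\mathscr A,\xi\in\mathcal H\}\subseteq\mathcal L$, which reduces $\varphi(\mathscr A)$; let $Q_{\Omega,\Lambda}$ be the orthogonal projection of $\mathcal L$ onto it, $\rho(A)=\varphi(A)|_{\mathcal K_{\Omega,\Lambda}}$ and $W=SV$. Then $(\rho,\mathcal K_{\Omega,\Lambda},W)$ is a minimal Stinespring representation of $\Omega\circ\Lambda$. Lift: for $D\in\pi(\mathscr B)'$, $\Gamma_\Lambda^\Omega(D)\in\varphi(\mathscr A)'$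 is the unique bounded operator with $\Gamma_\Lambda^\Omega(D)\varphi(A)S\eta=\varphi(A)SD\eta$ for all $A\in\mathscr A$, $\eta\in\mathcal K_\Omega$; $\Gamma_\Lambda^\Omega$ is a unital $*$-homomorphism. Pullback transfer map: for positive $D\in\pi(\mathscr B)'$ let $\Omega_D(B)=V^*\pi(B)DV$, and let $\mathcal T_\Lambda^\Omega(D)=\frac{\mathrm d(\Omega_D\circ\Lambda)}{\mathrm d(\Omega\circ\Lambda)}\in\rho(\mathscr A)'$, computed in $(\rho,\mathcal K_{\Omega,\Lambda},W)$; $\mathcal T_\Lambda^\Omega$ is extended linearly to $\pi(\mathscr B)'$. *)

(* Defs.v *)
From HB Require Import structures.
From mathcomp Require Import all_boot all_order all_algebra.
From mathcomp Require Import complex.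
From mathcomp Require Import all_classical all_reals topology normedtype.

Set Implicit Arguments.
Unset Strict Implicit.
Unset Printing Implicit Defensive.

Import Order.TTheory GRing.Theory Num.Theory.
Import numFieldNormedType.Exports.

Local Open Scope classical_set_scope.
Local Open Scope ring_scope.

HB.mixin Record CompleteNormedModule_isHilbert (C : numClosedFieldType) H
    & CompleteNormedModule C H := {
  hdot : {dot H for (@Num.conj C)} ;
  hdot_norm : forall x : H, hdot x x = `|x| ^+ 2
}.

#[short(type="hilbertType")]
HB.structure Definition Hilbert (C : numClosedFieldType) :=
  {H of CompleteNormedModule C H & CompleteNormedModule_isHilbert C H}.

Notation "''[' x , y ]" := (hdot x y)
  (at level 0, format "''[' x ,  y ]") : ring_scope.

(* Unital C*-algebras, the zero algebra included. The product is a field of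
   the mixin: a structure joining pzRingType and completeNormedModType C would
   have to be declared before numDomainType. The ring operations are recovered
   from the instance that follows. *)
HB.mixin Record CompleteNormedModule_isCStarAlgebra (C : numClosedFieldType) A
    & CompleteNormedModule C A := {
  cone : A ;
  cmul : A -> A -> A ;
  cmulA : associative cmul ;
  cmul1l : left_id cone cmul ;
  cmul1r : right_id cone cmul ;
  cmulDl : left_distributive cmul +%R ;
  cmulDr : right_distributive cmul +%R ;
  cmulZl : forall (a : C) (x y : A), cmul (a *: x) y = a *: cmul x y ;
  cmulZr : forall (a : C) (x y : A), cmul x (a *: y) = a *: cmul x y ;
  cmul_norm : forall x y : A, `|cmul x y| <= `|x| * `|y| ;
  star : A -> A ;
  starD : forall x y, star (x + y) = star x + star y ;
  starZ : forall (a : C) x, star (a *: x) = Num.conj a *: star x ;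
  starM : forall x y, star (cmul x y) = cmul (star y) (star x) ;
  starK : involutive star ;
  star_norm : forall x, `|cmul (star x) x| = `|x| ^+ 2
}.

#[short(type="cstarType")]
HB.structure Definition CStarAlgebra (C : numClosedFieldType) :=
  {A of CompleteNormedModule C A & CompleteNormedModule_isCStarAlgebra C A}.

#[non_forgetful_inheritance]
HB.instance Definition _ (C : numClosedFieldType) (A : cstarType C) :=
  GRing.Zmodule_isPzRing.Build A (@cmulA C A) (@cmul1l C A) (@cmul1r C A)
    (@cmulDl C A) (@cmulDr C A).

Section BoundedOperators.
Context {C : numClosedFieldType}.

Section Def.
Context {H K : hilbertType C}.

Definition bounded_op : {pred H -> K} :=
  fun f => `[< linear f /\ continuous f >].

Lemma bounded_opP f : reflect (linear f /\ continuous f) (f \in bounded_op).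
Proof. exact: asboolP. Qed.

Lemma bounded_op_submod : GRing.subsemimod_closed bounded_op.
Proof.
apply: GRing.submod_closed_semi; split.
  apply/bounded_opP; split=> [a x y|x]; first by rewrite /= scaler0 addr0.
  exact: cst_continuous.
move=> a f g /bounded_opP[fl fc] /bounded_opP[gl gc].
apply/bounded_opP; split=> [b x y|x].
  rewrite /= !fctE fl gl !scalerDr !scalerA [a * b]mulrC.
  by rewrite -!addrA; congr (_ + _); rewrite addrCA.
apply: (@continuousD C K _ (a *: f) g); last exact: gc.
exact: (@continuousZr _ _ _ f a x (fc x)).
Qed.

Record bop := BOp { bop_fun :> H -> K ; bop_funP : bop_fun \in bounded_op }.

HB.instance Definition _ := [isSub for bop_fun].
HB.instance Definition _ := [Choice of bop by <:].
HB.instance Definition _ :=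
  GRing.SubChoice_isSubLmodule.Build C (H -> K) _ bop bounded_op_submod.

Lemma bop_linear (T : bop) : linear T.
Proof. by case: (bounded_opP _ (bop_funP T)). Qed.

Lemma bop_continuous (T : bop) : continuous T.
Proof. by case: (bounded_opP _ (bop_funP T)). Qed.

HB.instance Definition _ (T : bop) :=
  GRing.isLinear.Build C H K *:%R T (bop_linear T).

End Def.
Arguments bop : clear implicits.

Lemma bop_id_subproof (H : hilbertType C) : (@idfun H) \in bounded_op.
Proof. by apply/bounded_opP; split=> // x; exact: cvg_id. Qed.

Definition bop_id (H : hilbertType C) : bop H H := BOp (bop_id_subproof H).

Lemma bop_comp_subproof (H K L : hilbertType C) (S : bop K L) (T : bop H K) :
  (S \o T) \in bounded_op.
Proof.
apply/bounded_opP; split=> [a x y|x]; first by rewrite /= !linearP.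
by apply: continuous_comp; exact: bop_continuous.
Qed.

Definition bop_comp (H K L : hilbertType C) (S : bop K L) (T : bop H K) :
  bop H L := BOp (bop_comp_subproof S T).

(* The adjoint exists (for C = R[i]) and is unique, by the Riesz
   representation theorem. *)
Definition adjoint (H K : hilbertType C) (T : bop H K) : bop K H :=
  xget 0 [set T' : bop K H | forall x y, '[T x, y] = '[x, T' y]].

Definition positive_op (H : hilbertType C) (T : bop H H) : Prop :=
  forall x, 0 <= '[T x, x].

End BoundedOperators.
Arguments bop {C}.

Notation "S \bo T" := (bop_comp S T)
  (at level 50, left associativity) : ring_scope.
Notation "T ^\dag" := (adjoint T) (at level 1, format "T ^\dag") : ring_scope.

Section ClosedSubspace.
Context {C : numClosedFieldType} {L : hilbertType C}.

Record closedSubspace := ClosedSubspace {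
  subspace_set :> set L ;
  subspace_submod : GRing.submod_closed [in subspace_set] ;
  subspace_closed : closed subspace_set
}.

Section SubspaceType.
Variable M : closedSubspace.

Record sub_hilbert := SubHilbert {
  sub_hilbert_val : L ;
  sub_hilbertP : sub_hilbert_val \in subspace_set M
}.

HB.instance Definition _ := [isSub for sub_hilbert_val].
HB.instance Definition _ := [Choice of sub_hilbert by <:].
HB.instance Definition _ :=
  GRing.SubChoice_isSubLmodule.Build C L _ sub_hilbert
    (GRing.submod_closed_semi (subspace_submod M)).

Let norm (x : sub_hilbert) : C := `|val x|.

Let ler_normD x y : norm (x + y) <= norm x + norm y.
Proof. exact: ler_normD. Qed.

Let normrZ (a : C) x : norm (a *: x) = `|a| * norm x.
Proof. by rewrite /norm linearZ normrZ. Qed.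

Let normr0_eq0 x : norm x = 0 -> x = 0.
Proof. by move=> /normr0_eq0 x0; exact: val_inj. Qed.

HB.instance Definition _ := Lmodule_isNormed.Build C sub_hilbert
  ler_normD normrZ normr0_eq0.

Let complete (F : set_system sub_hilbert) : ProperFilter F -> cauchy F -> cvg F.
Proof.
move=> FF /cauchy_ballP Fc.
have /cvg_ex[l Gl] : cvg (val @ F).
  apply: cauchy_cvg; apply/cauchy_ballP => e e0.
  have [[P Q] [/= FP FQ] PQ] := Fc _ e0.
  exists ([set val x | x in P], [set val x | x in Q]).
    by split; [apply: filterS FP | apply: filterS FQ] => x ?; exists x.
  move=> [_ _] [/= [x Px <-] [y Qy <-]].
  have := PQ (x, y) (conj Px Qy).
  by rewrite -!ball_normE /= /ball_ /= -[`|x - y|]/(norm (x - y)) /norm linearB.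
have Ml : subspace_set M l.
  apply: (closed_cvg _ (@subspace_closed M) _ _ Gl).
  by apply: nearW => x; apply: set_mem; exact: sub_hilbertP.
apply/cvg_ex; exists (SubHilbert (mem_set Ml)).
apply/cvgrPdist_lt => e e0; move/cvgrPdist_lt : Gl => /(_ _ e0).
by apply: filterS => x; rewrite -[`|_ - x|]/(norm _) /norm linearB.
Qed.

HB.instance Definition _ := Uniform_isComplete.Build sub_hilbert complete.

Definition sub_hdot (x y : sub_hilbert) : C := '[val x, val y].

Let sub_hdot_bilinear :
  bilinear_for (GRing.Scale.Law.clone _ _ *%R _)
    (GRing.Scale.Law.clone _ _ (Num.conj \; *%R) _) sub_hdot.
Proof.
have valE a u v : val (a *: u + v : sub_hilbert) = a *: val u + val v :> L.
  exact: linearP.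
split=> [y|x] a u v; rewrite /sub_hdot valE; first exact: linearPl.
exact: linearPr.
Qed.

HB.instance Definition _ :=
  bilinear_isBilinear.Build C sub_hilbert sub_hilbert C _ _ sub_hdot
    sub_hdot_bilinear.

Let sub_hdotC x y : sub_hdot x y = (-1) ^+ false * Num.conj (sub_hdot y x).
Proof. exact: hermC. Qed.

HB.instance Definition _ :=
  isHermitianSesquilinear.Build C sub_hilbert false Num.conj sub_hdot sub_hdotC.

Let sub_hdot_gt0 x : x != 0 -> 0 < sub_hdot x x.
Proof.
by move=> x0; rewrite /sub_hdot hdot_norm exprn_gt0// normr_gt0.
Qed.

HB.instance Definition _ :=
  isDotProduct.Build C sub_hilbert sub_hdot sub_hdot_gt0.

Let sub_hdot_norm (x : sub_hilbert) : sub_hdot x x = `|x| ^+ 2.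
Proof. exact: hdot_norm. Qed.

HB.instance Definition _ :=
  CompleteNormedModule_isHilbert.Build C sub_hilbert sub_hdot_norm.

End SubspaceType.

Definition lin_span (X : set L) : set L :=
  [set x | exists2 s : seq (C * L), (forall p, p \in s -> X p.2) &
           x = \sum_(p <- s) p.1 *: p.2].

Lemma lin_span_linear X a x y :
  lin_span X x -> lin_span X y -> lin_span X (a *: x + y).
Proof.
move=> [s sX ->] [t tX ->]; exists ([seq (a * p.1, p.2) | p <- s] ++ t).
  by move=> p; rewrite mem_cat => /orP[/mapP[q /sX Xq ->]|/tX].
rewrite big_cat big_map scaler_sumr /=; congr (_ + _).
by apply: eq_bigr => p _; rewrite scalerA.
Qed.

Let closed_span_submod (X : set L) :
  GRing.submod_closed [in closure (lin_span X)].
Proof.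
split; first by apply/mem_set/subset_closure; exists [::]; rewrite ?big_nil.
move=> a x y /set_mem Xx /set_mem Xy; apply/mem_set => B.
have /[apply] : (fun p : L * L => a *: p.1 + p.2) @ (x, y) --> a *: x + y.
  apply: cvgD; last exact: cvg_snd.
  by apply: cvgZr; exact: cvg_fst.
move=> [[P Q] [/= /Xx[u [Xu Pu]] /Xy[v [Xv Qv]]] PQB].
exists (a *: u + v); split; first exact: lin_span_linear.
exact: (PQB (u, v)).
Qed.

Let closed_span_closed (X : set L) : closed (closure (lin_span X)).
Proof. exact: closed_closure. Qed.

Definition closed_span (X : set L) : closedSubspace :=
  ClosedSubspace (closed_span_submod X) (@closed_span_closed X).

(* The projection exists (for C = R[i]) and is unique, by the projection
   theorem. *)
Definition orth_proj (M : closedSubspace) : bop L L :=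
  xget 0 [set Q : bop L L | forall x, subspace_set M (Q x) /\
                              forall y, subspace_set M y -> '[x - Q x, y] = 0].

(* T with its codomain restricted to M; 0 if T does not map into M *)
Definition corestrict_op (H : hilbertType C) (M : closedSubspace) (T : bop H L) :
  bop H (sub_hilbert M) :=
  xget 0 [set T' : bop H (sub_hilbert M) | forall x, val (T' x) = T x].

(* the restriction of T to M; 0 if M is not invariant under T *)
Definition restrict_op (M : closedSubspace) (T : bop L L) :
  bop (sub_hilbert M) (sub_hilbert M) :=
  xget 0 [set T' : bop (sub_hilbert M) (sub_hilbert M) |
           forall x, val (T' x) = T (val x)].

End ClosedSubspace.
Arguments closedSubspace {C}.

Section CompletelyPositive.
Context {C : numClosedFieldType}.

Definition mx_pos (A : cstarType C) n (a : 'M[A]_n) : Prop :=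
  exists y : 'M[A]_n, a = map_mx star y^T *m y.

Definition completely_positive (A B : cstarType C) (Phi : A -> B) : Prop :=
  linear Phi /\
  forall n (a : 'M[A]_n), mx_pos a -> mx_pos (map_mx Phi a).

(* M_n(B(H)) is identified with B(H^n), where positivity means that the
   quadratic form of the operator is nonnegative. *)
Definition completely_positive_op (A : cstarType C) (H : hilbertType C)
    (Phi : A -> bop H H) : Prop :=
  linear Phi /\
  forall n (a : 'M[A]_n), mx_pos a -> forall x : 'I_n -> H,
    0 <= \sum_i \sum_j '[Phi (a i j) (x j), x i].

Definition unital_star_rep (A : cstarType C) (K : hilbertType C)
    (sigma : A -> bop K K) : Prop :=
  [/\ linear sigma, sigma 1 = bop_id K,
      forall x y, sigma (x * y) = sigma x \bo sigma y &
      forall x, sigma (star x) = (sigma x)^\dag].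

Definition commutant (A : cstarType C) (K : hilbertType C)
    (sigma : A -> bop K K) : set (bop K K) :=
  [set D | forall a, D \bo sigma a = sigma a \bo D].

Definition stinespring (A : cstarType C) (G K : hilbertType C)
    (Psi : A -> bop G G) (sigma : A -> bop K K) (T : bop G K) : Prop :=
  unital_star_rep sigma /\ forall a, Psi a = T^\dag \bo sigma a \bo T.

Definition minimal_stinespring (A : cstarType C) (G K : hilbertType C)
    (Psi : A -> bop G G) (sigma : A -> bop K K) (T : bop G K) : Prop :=
  stinespring Psi sigma T /\
  closure (lin_span [set y | exists a xi, y = sigma a (T xi)]) = setT.

(* dPhi/dPsi, computed in a minimal Stinespring representation
   (sigma, K, T) of Psi *)
Definition radon_nikodym (A : cstarType C) (G K : hilbertType C)
    (sigma : A -> bop K K) (T : bop G K) (Phi : A -> bop G G) : bop K K :=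
  xget 0 [set E : bop K K | [/\ positive_op E, commutant sigma E &
                forall a, Phi a = T^\dag \bo sigma a \bo E \bo T]].

End CompletelyPositive.

Section Transfer.
Context {C : numClosedFieldType} {A B : cstarType C} {H K L : hilbertType C}.
Variables (Lambda : A -> B) (pi : B -> bop K K) (V : bop H K).
Variables (phi : A -> bop L L) (S : bop K L).

Definition K_OL : closedSubspace L :=
  closed_span [set y | exists a xi, y = phi a (S (V xi))].

Definition Q_OL : bop L L := orth_proj K_OL.

Definition rho (a : A) : bop (sub_hilbert K_OL) (sub_hilbert K_OL) :=
  restrict_op K_OL (phi a).

Definition W_OL : bop H (sub_hilbert K_OL) := corestrict_op K_OL (S \bo V).

Definition Omega_ (D : bop K K) (b : B) : bop H H := V^\dag \bo pi b \bo D \bo V.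

Definition Gamma_lift (D : bop K K) : bop L L :=
  xget 0 [set G : bop L L | commutant phi G /\
           forall a eta, G (phi a (S eta)) = phi a (S (D eta))].

(* The linear extension is determined on the commutant of pi, which is
   spanned by its positive elements; its values elsewhere are irrelevant. *)
Definition transfer : bop K K -> bop (sub_hilbert K_OL) (sub_hilbert K_OL) :=
  xget (fun=> 0)
    [set T : bop K K -> bop (sub_hilbert K_OL) (sub_hilbert K_OL) |
      (forall a D1 D2, commutant pi D1 -> commutant pi D2 ->
         T (a *: D1 + D2) = a *: T D1 + T D2) /\
      (forall D, commutant pi D -> positive_op D ->
         T D = radon_nikodym rho W_OL (Omega_ D \o Lambda))].

End Transfer.

(* Main.v *)
(* Gamma(D) acts on sum_j phi(a_j) S eta_j by eta_j |-> D eta_j.  Since Lambda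
   is completely positive, [Lambda (a_i^* a_j)] = c^* c for a matrix c over B,
   so the inner product of sum_j phi(a_j) S D1 eta_j and
   sum_i phi(a_i) S D2 eta_i is sum_k <D1 z_k, D2 z_k> for vectors z_k that do
   not depend on D1, D2 in pi(B)'.  Taking (D, D) and (1, 1) bounds Gamma(D) by
   the norm of D; taking (D, 1) shows that Gamma preserves positivity.  The
   compression of Gamma(D) to K_OL then has the defining properties of
   d(Omega_D o Lambda)/d(Omega o Lambda) when D is positive, and the general
   case follows because positive operators span pi(B)'. *)
Require Import Defs.
From HB Require Import structures.
From mathcomp Require Import all_boot all_order all_algebra.
From mathcomp Require Import complex.
From mathcomp Require Import all_classical all_reals topology normedtype.
From mathcomp Require Import ring.

Set Implicit Arguments.
Unset Strict Implicit.
Unset Printing Implicit Defensive.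

Import Order.TTheory GRing.Theory Num.Theory.
Import numFieldNormedType.Exports.

Local Open Scope classical_set_scope.
Local Open Scope ring_scope.

(** * Inner products and bounded operators *)

Section InnerProduct.
Context {C : numClosedFieldType} {H : hilbertType C}.
Implicit Types x y z : H.

Lemma hdotC x y : '[x, y] = ('[y, x])^*.
Proof. by rewrite (hermC hdot) expr0 mul1r. Qed.

Lemma hdotDl x y z : '[x + y, z] = '[x, z] + '[y, z].
Proof. exact: linearDl. Qed.

Lemma hdotDr x y z : '[x, y + z] = '[x, y] + '[x, z].
Proof. exact: linearDr. Qed.

Lemma hdotBl x y z : '[x - y, z] = '[x, z] - '[y, z].
Proof. exact: linearBl. Qed.

Lemma hdotBr x y z : '[x, y - z] = '[x, y] - '[x, z].
Proof. exact: linearBr. Qed.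

Lemma hdotZl a x y : '[a *: x, y] = a * '[x, y].
Proof. exact: linearZl_LR. Qed.

Lemma hdotZr a x y : '[x, a *: y] = a^* * '[x, y].
Proof. exact: linearZr_LR. Qed.

Lemma hdot0l x : '[0, x] = 0.
Proof. exact: linear0l. Qed.

Lemma hdot0r x : '[x, 0] = 0.
Proof. exact: linear0r. Qed.

Lemma hdot_suml I (r : seq I) (F : I -> H) y :
  '[\sum_(i <- r) F i, y] = \sum_(i <- r) '[F i, y].
Proof. exact: linear_sumlz. Qed.

Lemma hdot_sumr I (r : seq I) (F : I -> H) x :
  '[x, \sum_(i <- r) F i] = \sum_(i <- r) '[x, F i].
Proof. exact: linear_sumr. Qed.

Lemma hdot_ge0 x : 0 <= '[x, x].
Proof. by rewrite hdot_norm exprn_ge0. Qed.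

Lemma hdot_eq0 x : '[x, x] = 0 -> x = 0.
Proof. by move/eqP; rewrite hdot_norm sqrf_eq0 normr_eq0 => /eqP. Qed.

Lemma hdot_inj x y : (forall z, '[x, z] = '[y, z]) -> x = y.
Proof.
move=> xy; apply/eqP; rewrite -subr_eq0; apply/eqP/hdot_eq0.
by rewrite hdotBl xy subrr.
Qed.

Lemma parallelogram x y :
  `|x + y| ^+ 2 + `|x - y| ^+ 2 = `|x| ^+ 2 *+ 2 + `|y| ^+ 2 *+ 2.
Proof.
by rewrite -!hdot_norm !hdotDl !hdotDr !linearNl !linearNr opprK; ring.
Qed.

(** Pythagoras: this [a] makes [x - a *: y] orthogonal to [y]. Dropping the residual gives
    Cauchy-Schwarz. *)
Lemma hdot_decomp x y (a := '[x, y] / '[y, y]) : y != 0 ->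
  `|x| ^+ 2 = `|x - a *: y| ^+ 2 + `|a| ^+ 2 * `|y| ^+ 2.
Proof.
move=> y0.
have yy : '[y, y] != 0 by rewrite hdot_norm sqrf_eq0 normr_eq0.
have uy : '[x - a *: y, a *: y] = 0.
  by rewrite hdotZr hdotBl hdotZl divfK// subrr mulr0.
by rewrite -exprMn -normrZ -!hdot_norm -(@hnormDd _ _ _ _ (@hdot C H)) ?subrK.
Qed.

Lemma hdot_le x y : `|'[x, y]| <= `|x| * `|y|.
Proof.
have [->|y0] := eqVneq y 0; first by rewrite hdot0r !normr0 mulr0.
have xE := hdot_decomp x y0; rewrite -(@ler_pXn2r _ 2) ?nnegrE ?mulr_ge0//.
rewrite exprMn {}xE normrM normfV hdot_norm normrX normr_id mulrDl.
rewrite [X in _ <= _ + X](_ : _ = `|'[x, y]| ^+ 2); last first.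
  by field; rewrite normr_eq0.
by rewrite [leRHS]addrC lerDl mulr_ge0 ?exprn_ge0.
Qed.

(** Taking for [c] the coefficient of [hdot_decomp], minimality forces the component of [x] along
    [y] to vanish. *)
Lemma closest_orthogonal x y :
  (forall c, `|x| ^+ 2 <= `|x - c *: y| ^+ 2) -> '[x, y] = 0.
Proof.
have [->|y0] := eqVneq y 0; first by rewrite hdot0r.
move=> /(_ ('[x, y] / '[y, y])); rewrite (hdot_decomp x y0) gerDl.
rewrite -exprMn -normrZ -hdot_norm => ay0.
have /eqP := hdot_eq0 (le_anti (introT andP (conj ay0 (hdot_ge0 _)))).
rewrite scaler_eq0 (negPf y0) orbF mulf_eq0 invr_eq0 hdot_norm.
by rewrite sqrf_eq0 normr_eq0 (negPf y0) orbF => /eqP.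
Qed.

End InnerProduct.

Section BoundedOps.
Context {C : numClosedFieldType}.
Implicit Types H K L : hilbertType C.

Lemma bop_ext H K (S T : bop H K) : S =1 T -> S = T.
Proof. by move=> ST; apply: val_inj; apply/funext. Qed.

Lemma bop_linE H K (a : C) (S T : bop H K) x : (a *: S + T) x = a *: S x + T x.
Proof. by []. Qed.

Lemma bop_compE H K L (S : bop K L) (T : bop H K) x : (S \bo T) x = S (T x).
Proof. by []. Qed.

Lemma bop_lin H K (T : bop H K) a x y : T (a *: x + y) = a *: T x + T y.
Proof. exact: bop_linear. Qed.

Lemma bopB H K (T : bop H K) x y : T (x - y) = T x - T y.
Proof. exact: linearB. Qed.

Lemma bopZ H K (T : bop H K) a x : T (a *: x) = a *: T x.
Proof. exact: linearZ. Qed.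

Lemma bop0 H K (T : bop H K) : T 0 = 0.
Proof. exact: linear0. Qed.

Lemma bop_sum H K (T : bop H K) I (r : seq I) (F : I -> H) :
  T (\sum_(i <- r) F i) = \sum_(i <- r) T (F i).
Proof. exact: linear_sum. Qed.

Lemma bop_bounded H K (T : bop H K) :
  exists2 M : C, 0 < M & forall x, `|T x| <= M * `|x|.
Proof.
have /linear_bounded_continuous/linear_boundedP/pinfty_ex_gt0[M M0 TM] :=
  @bop_continuous _ _ _ T.
by exists M.
Qed.

Lemma lipschitz_linear_continuous (V W : normedModType C) (f : V -> W) (M : C) :
  0 <= M -> linear f -> (forall x, `|f x| <= M * `|x|) -> continuous f.
Proof.
move=> M0 flin fM.
pose F : {linear V -> W} := HB.pack f (GRing.isLinear.Build C V W *:%R f flin).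
suff /bounded_linear_continuous : bounded_near F (nbhs (0 : V)) by [].
apply/linear_boundedP; near=> r => x.
rewrite (le_trans (fM x))// ler_wpM2r//.
by near: r; apply: nbhs_pinfty_ge; exact: ger0_real.
Unshelve. all: by end_near. Qed.

(** Projections, adjoints, extensions and corestrictions all enter [bop] this way. *)
Lemma bop_intro H K (f : H -> K) (M : C) : 0 <= M -> linear f ->
  (forall x, `|f x| <= M * `|x|) -> exists T : bop H K, T =1 f.
Proof.
move=> M0 flin /(lipschitz_linear_continuous M0 flin) fc.
have fP : f \in bounded_op by apply/bounded_opP; split.
by exists (BOp fP).
Qed.

Lemma hdot_continuous H K (S T : bop H K) : 
  continuous (fun x => '[S x, T x] : C^o).
Proof.
move=> a; have [M M0 SM] := bop_bounded S; have [N N0 TN] := bop_bounded T.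
apply/(@cvgrPdist_lt _ C^o) => e e0.
(* The first two terms of [d] bound the norms of [a] and [x], which multiply [M * N * |a - x|] in
   the estimate below; the last 1 is slack. *)
pose d := `|a| + (`|a| + 1) + 1.
have d0 : 0 < d by rewrite ltr_wpDl// !addr_ge0.
near=> x.
have xa : `|a - x| < e / (M * N * d).
  near: x; apply: cvgr_dist_lt; last by rewrite divr_gt0// !mulr_gt0.
  exact: cvg_id.
have x1 : `|x| < `|a| + 1.
  by near: x; apply: cvgr_norm_lt; [exact: cvg_id|rewrite ltrDl].
have -> : '[S a, T a] - '[S x, T x] = '[S (a - x), T a] + '[S x, T (a - x)].
  by rewrite !bopB hdotBl hdotBr addrA subrK.
apply: (@le_lt_trans _ _ (M * `|a - x| * (N * `|a|) +
                          M * (`|a| + 1) * (N * `|a - x|))).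
  rewrite (le_trans (ler_normD _ _))// lerD// (le_trans (hdot_le _ _))//.
    by rewrite ler_pM.
  rewrite ler_pM// (le_trans (SM _))// ler_pM// ltW//.
rewrite (_ : _ + _ = `|a - x| * (M * N * (`|a| + (`|a| + 1)))); last by ring.
apply: (@le_lt_trans _ _ (`|a - x| * (M * N * d))).
  by rewrite ler_wpM2l// ler_wpM2l ?mulr_ge0 ?ltW// ltrDl.
by rewrite -ltr_pdivlMr// !mulr_gt0.
Unshelve. all: by end_near. Qed.

Lemma hdotr_continuous H K (T : bop H K) y :
  continuous (fun x => '[T x, y] : C^o).
Proof.
have [M M0 TM] := bop_bounded T.
apply: (@lipschitz_linear_continuous H C^o _ (M * `|y|)).
- by rewrite mulr_ge0// ltW.
- by move=> a u v; rewrite bop_lin hdotDl hdotZl.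
- by move=> x; rewrite (le_trans (hdot_le _ _))// mulrAC ler_wpM2r.
Qed.

(* C is only partially ordered: closedness is read off 0 <= z <-> `|z| = z. *)
Lemma closed_ge0 : closed [set z : C^o | 0 <= z].
Proof.
rewrite (_ : mkset _ = (fun z : C^o => `|z| - z) @^-1` [set 0]).
  apply: preimage_closed.
    move=> z _; apply: (@cvgB _ C^o _ _ (nbhs_filter z)).
      exact: (@norm_continuous _ C^o z).
    exact: cvg_id.
  exact/accessible_closed_set1/hausdorff_accessible/norm_hausdorff.
apply/seteqP; split => z /=; first by move=> /ger0_norm ->; rewrite subrr.
by move=> /eqP; rewrite subr_eq0 => /eqP <-.
Qed.

Lemma closure_sub_closed (T : topologicalType) (X F : set T) :
  X `<=` F -> closed F -> closure X `<=` F.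
Proof. by move=> XF /closure_id ->; exact: closure_subset. Qed.

(** The quadratic form of [T] is continuous and the nonnegative numbers form a closed set. *)
Lemma positive_op_dense H (T : bop H H) (X : set H) : closure X = setT ->
  (forall x, X x -> 0 <= '[T x, x]) -> positive_op T.
Proof.
move=> Xd XT x.
have : closure X x by rewrite Xd.
apply: (@closure_sub_closed H X [set y | 0 <= '[T y, y]]); first exact: XT.
apply: (@preimage_closed H C^o (fun y => '[T y, y]) _ _ closed_ge0).
by move=> y _; exact: (@hdot_continuous _ _ T (bop_id H) y).
Qed.

Lemma bop_eq_closure H K (S T : bop H K) (X : set H) :
  (forall x, X x -> S x = T x) -> closure X `<=` [set x | S x = T x].
Proof.
move=> ST.
apply: (@closure_sub_closed H X [set x | S x = T x]); first exact: ST.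
rewrite (_ : mkset _ = (fun x => S x - T x) @^-1` [set 0]).
  apply: preimage_closed.
    by move=> z _; apply: cvgB; exact: bop_continuous.
  exact/accessible_closed_set1/hausdorff_accessible/norm_hausdorff.
apply/seteqP; split => z /=; first by move=> ->; rewrite subrr.
by move=> /eqP; rewrite subr_eq0 => /eqP <-.
Qed.

(** The equaliser of two operators is a closed subspace. Combined with minimality, this identifies
    operators from their values on generators. *)
Lemma bop_eq_span H K (S T : bop H K) (X : set H) :
  (forall x, X x -> S x = T x) -> closure (lin_span X) `<=` [set x | S x = T x].
Proof.
move=> ST; apply: bop_eq_closure => _ [s sX ->].
rewrite !bop_sum; apply: eq_big_seq => p ps.
by rewrite !bopZ ST//; exact: sX.
Qed.

End BoundedOps.

(** * Orthogonal projection, Riesz representation and adjoints *)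

Section Projection.
Context {R : realType}.
Implicit Types H K L : hilbertType R[i].

(** Nonnegative elements of [R[i]] are real, so the infimum is taken in [R] over real parts. *)
Lemma complex_inf (S : set R[i]) : S !=set0 -> (forall s, S s -> 0 <= s) ->
  exists2 d, (forall s, S s -> d <= s) &
             forall e, 0 < e -> exists2 s, S s & s < d + e.
Proof.
move=> [s0 Ss0] S0.
have ReK (s : R[i]) : 0 <= s -> s = (complex.Re s)%:C%C.
  by move=> /ger0_real/RRe_real.
pose U : set R := [set complex.Re s | s in S].
have Ulb : lbound U 0.
  by move=> _ [s Ss <-]; rewrite -lecR -ReK ?S0.
have Uinf : has_inf U by split; [exists (complex.Re s0), s0 | exists 0].
exists (inf U)%:C%C => [s Ss|e e0].
  rewrite (ReK s) ?S0// lecR; apply: ge_inf; [by exists 0|by exists s].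
have eE := ReK _ (ltW e0).
have e0' : 0 < complex.Re e by rewrite -ltcR -eE.
have [_ [s Ss <-] sU] := inf_adherent e0' Uinf.
by exists s => //; rewrite (ReK s) ?S0// eE -rmorphD ltcR.
Qed.

Lemma subspace0 L (M : closedSubspace L) : subspace_set M 0.
Proof. by have [/set_mem] := subspace_submod M. Qed.

Lemma subspace_lin L (M : closedSubspace L) a u v :
  subspace_set M u -> subspace_set M v -> subspace_set M (a *: u + v).
Proof.
move=> /mem_set Mu /mem_set Mv; apply: set_mem.
by have [_] := subspace_submod M; exact.
Qed.

Lemma subspaceB L (M : closedSubspace L) u v :
  subspace_set M u -> subspace_set M v -> subspace_set M (u - v).
Proof.
by move=> Mu Mv; rewrite addrC -scaleN1r; exact: subspace_lin.
Qed.

(** Near-minimisers of the distance form a filter, Cauchy by the parallelogram identity; its limit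
    is the closest point. *)
Lemma closest_point L (M : closedSubspace L) x :
  exists2 l, subspace_set M l &
    forall y, subspace_set M y -> `|x - l| ^+ 2 <= `|x - y| ^+ 2.
Proof.
have [||d dmin dinf] := complex_inf (S := [set `|x - y| ^+ 2 | y in M]).
- by exists (`|x - 0| ^+ 2), 0 => //; exact: subspace0.
- by move=> _ [y _ <-]; rewrite exprn_ge0.
pose B (e : R[i]) := [set y | subspace_set M y /\ `|x - y| ^+ 2 < d + e].
pose F := filter_from [set e : R[i] | 0 < e] B.
have FF : ProperFilter F.
  apply: filter_from_proper; last first.
    by move=> e /= /dinf[_ [y My <-] ye]; exists y.
  apply: filter_from_filter; first by exists 1 => /=.
  move=> e f /= e0 f0.
  have [ef|/ltW fe] := real_leP (gtr0_real e0) (gtr0_real f0).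
    exists e => // y [My ye]; split; split=> //.
    by rewrite (lt_le_trans ye)// lerD2l.
  exists f => // y [My ye]; split; split=> //.
  by rewrite (lt_le_trans ye)// lerD2l.
have Fc : cauchy F.
  apply: cauchy_exP => e e0.
  (* Two squared distances below [d + e ^+ 2 / 4], and one of at least [d] at the midpoint, leave
     less than [e ^+ 2] for the square of [|m - y|]. *)
  have d0 : 0 < e ^+ 2 / 4 :> R[i] by rewrite divr_gt0 ?exprn_gt0.
  have [_ [m Mm <-] me] := dinf _ d0.
  exists m, (e ^+ 2 / 4) => // y [My ye].
  rewrite -ball_normE /=.
  rewrite -(@ltr_pXn2r _ 2) ?nnegrE// 1?ltW//.
  have Mmid : subspace_set M (2^-1 *: m + 2^-1 *: y).
    apply: (subspace_lin _ Mm); rewrite -[_ *: y]addr0.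
    exact: (subspace_lin _ My (subspace0 M)).
  have := dmin _ (ex_intro2 _ _ _ Mmid erefl).
  have := parallelogram (x - m) (x - y).
  have -> : x - m + (x - y) = 2 *: (x - (2^-1 *: m + 2^-1 *: y)).
    rewrite scalerBr scalerDr !scalerA divff ?scale1r ?pnatr_eq0//.
    by rewrite scaler_nat mulr2n addrACA -opprD.
  have -> : x - m - (x - y) = - (m - y).
    by rewrite opprB addrC addrA subrK opprB.
  rewrite normrN normrZ exprMn normr_nat; set w := `|_ - (_ + _)| ^+ 2.
  move=> par dw; rewrite -(ltrD2l (2 ^+ 2 * w)) par.
  apply: (@lt_le_trans _ _ ((d + e ^+ 2 / 4) *+ 2 + (d + e ^+ 2 / 4) *+ 2)).
    by rewrite ltrD// ltrMn2r.
  rewrite (_ : _ + _ = 2 ^+ 2 * d + e ^+ 2); last by field.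
  by rewrite lerD2r ler_wpM2l ?exprn_ge0.
have /cvg_ex[l Fl] : cvg F by exact: cauchy_cvg.
exists l.
  apply: (@closed_cvg _ _ F FF id _ (@subspace_closed _ _ M) _ l Fl).
  by exists 1 => [/=|y []].
move=> y My; apply/ler_addgt0Pr => e e0; rewrite -subr_ge0.
(* Members of [B e] satisfy [0 <= g], a closed condition, so the limit [l] does too. *)
pose g (z : L) : R[i]^o := `|x - y| ^+ 2 + e - `|x - z| ^+ 2.
have gc : continuous g.
  move=> z; apply: (@cvgB _ R[i]^o _ _ (nbhs_filter z)); first exact: cvg_cst.
  rewrite /= expr2.
  have xc : (`|x - t| : R[i]^o) @[t --> z] --> (`|x - z| : R[i]^o).
    by apply: cvg_norm; apply: cvgB; [exact: cvg_cst|exact: cvg_id].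
  exact: (cvgM xc xc).
have gclosed : closed (g @^-1` [set t | 0 <= t]).
  by apply: preimage_closed closed_ge0 => z _; exact: gc.
apply: (@closed_cvg _ _ F FF id _ gclosed _ l Fl).
exists e => //= z [_ ze]; rewrite /g subr_ge0 (le_trans (ltW ze))// lerD2r.
by apply: dmin; exists y.
Qed.

(** [m - n] lies in [M] and, as the difference of [x - n] and [x - m], is orthogonal to [M]. *)
Lemma orth_decomp_uniq L (M : closedSubspace L) x m n :
  subspace_set M m -> (forall y, subspace_set M y -> '[x - m, y] = 0) ->
  subspace_set M n -> (forall y, subspace_set M y -> '[x - n, y] = 0) ->
  m = n.
Proof.
move=> Mm xm Mn xn; apply/eqP; rewrite -subr_eq0; apply/eqP/hdot_eq0.
have Mmn := subspaceB Mm Mn.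
have mn : m - n = x - n - (x - m) by rewrite [RHS]addrC opprB addrA subrK.
by rewrite {1}mn hdotBl xm// xn// subrr.
Qed.

(** Validates the [xget] in [orth_proj]. Comparing a closest point [m] with [m + c *: y] shows that
    its residual is orthogonal to [M]; uniqueness gives linearity and Pythagoras the bound 1. *)
Lemma orth_projP L (M : closedSubspace L) x :
  subspace_set M (orth_proj M x) /\
  forall y, subspace_set M y -> '[x - orth_proj M x, y] = 0.
Proof.
suff /(xgetPex 0) : exists Q : bop L L, forall x, subspace_set M (Q x) /\
    forall y, subspace_set M y -> '[x - Q x, y] = 0 by apply.
have /choice[f fP] : forall x, exists m, subspace_set M m /\
    forall y, subspace_set M y -> '[x - m, y] = 0.
  move=> {}x; have [m Mm mmin] := closest_point M x.
  exists m; split=> // y My; apply: closest_orthogonal => c.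
  rewrite -addrA -opprD; apply: mmin.
  by rewrite addrC; exact: subspace_lin.
have flin : linear f.
  move=> a u v; have [Mu uP] := fP u; have [Mv vP] := fP v.
  have [Muv uvP] := fP (a *: u + v).
  apply: (orth_decomp_uniq Muv uvP); first exact: subspace_lin.
  move=> y My; rewrite opprD addrACA -scalerBr hdotDl hdotZl uP// vP//.
  by rewrite mulr0 addr0.
have fle z : `|f z| <= 1 * `|z|.
  have [Mf zf] := fP z; rewrite mul1r -(@ler_pXn2r _ 2) ?nnegrE//.
  have fz : '[f z, z - f z] = 0 by rewrite hdotC zf// conjC0.
  have uf := zf _ Mf; move: fz uf; set u := z - f z => fu uf.
  have -> : `|z| ^+ 2 = '[u + f z, u + f z] by rewrite subrK hdot_norm.
  clearbody u; rewrite -hdot_norm hdotDl !hdotDr uf fu.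
  by rewrite addr0 add0r lerDr hdot_ge0.
have [Q QE] := bop_intro ler01 flin fle.
by exists Q => z; rewrite QE.
Qed.

Lemma orth_proj_eq L (M : closedSubspace L) x m : subspace_set M m ->
  (forall y, subspace_set M y -> '[x - m, y] = 0) -> orth_proj M x = m.
Proof.
by move=> Mm mP; have [MQ QP] := orth_projP M x; apply: orth_decomp_uniq mP.
Qed.

Lemma orth_proj_id L (M : closedSubspace L) x :
  subspace_set M x -> orth_proj M x = x.
Proof.
by move=> Mx; apply: orth_proj_eq => // y _; rewrite subrr hdot0l.
Qed.

Lemma hdot_orth_proj L (M : closedSubspace L) x y :
  subspace_set M y -> '[orth_proj M x, y] = '[x, y].
Proof.
move=> /(proj2 (orth_projP M x)); rewrite hdotBl => /eqP.
by rewrite subr_eq0 => /eqP.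
Qed.

(** The functional either vanishes or admits a nonzero [z] orthogonal to its closed kernel [N]; a
    multiple of [z] then represents it. *)
Lemma riesz H K (T : bop H K) y : exists z, forall x, '[T x, y] = '[x, z].
Proof.
pose N : set H := [set x | '[T x, y] = 0].
have Nsub : GRing.submod_closed [in N].
  split; first by apply/mem_set; rewrite /N /= bop0 hdot0l.
  move=> a u v /set_mem Nu /set_mem Nv; apply/mem_set.
  by rewrite /N /= bop_lin hdotDl hdotZl Nu Nv mulr0 addr0.
have Nclosed : closed N.
  apply: (@preimage_closed H R[i]^o (fun x => '[T x, y]) [set 0]).
    by move=> u _; exact: (@hdotr_continuous _ _ _ T y u).
  exact/accessible_closed_set1/hausdorff_accessible/norm_hausdorff.
pose M := ClosedSubspace Nsub Nclosed.
have [[x0 Tx0]|/forallNP T0] := pselect (exists x, '[T x, y] <> 0); last first.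
  by exists 0 => x; rewrite hdot0r; exact: contrapT (T0 x).
have [MQ QP] := orth_projP M x0; set z := x0 - _ in QP.
have Tz : '[T z, y] = '[T x0, y] by rewrite bopB hdotBl [X in _ - X]MQ subr0.
have zz : '[z, z] != 0.
  by apply/negP => /eqP/hdot_eq0 z0; apply: Tx0; rewrite -Tz z0 bop0 hdot0l.
exists (('[T z, y] / '[z, z])^* *: z) => x.
(* The left argument lies in the kernel [N], hence is orthogonal to [z]. *)
have : '['[T x, y] *: z - '[T z, y] *: x, z] = 0.
  rewrite hdotC QP ?conjC0//.
  by rewrite /M /= /N /= bopB hdotBl !bopZ !hdotZl mulrC subrr.
rewrite hdotBl !hdotZl hdotZr conjCK => /eqP; rewrite subr_eq0 => /eqP xE.
by rewrite mulrAC -xE mulfK.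
Qed.

(** Validates the [xget] in [adjoint]: Riesz vectors depend linearly on [y], and Cauchy-Schwarz
    applied to ['[f z, f z] = '[T (f z), z]] bounds them. *)
Lemma adjointE H K (T : bop H K) x y : '[T x, y] = '[x, T^\dag y].
Proof.
suff /(xgetPex 0) : exists T' : bop K H, forall x y, '[T x, y] = '[x, T' y].
  by apply.
have [f fP] := choice (riesz T); have [M M0 TM] := bop_bounded T.
have flin : linear f.
  move=> a u v; apply: hdot_inj => z.
  by rewrite hdotDl hdotZl !(hdotC (f _)) -!fP -!hdotC hdotDl hdotZl.
have fle z : `|f z| <= M * `|z|.
  have [->|fz0] := eqVneq `|f z| 0; first by rewrite mulr_ge0// ltW.
  rewrite -(@ler_pM2r _ `|f z|) ?lt0r ?fz0//= -expr2 -hdot_norm -fP.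
  rewrite -[leLHS]ger0_norm; last by rewrite fP hdot_ge0.
  by rewrite (le_trans (hdot_le _ _))// mulrAC ler_wpM2r.
have [T' T'E] := bop_intro (ltW M0) flin fle.
by exists T' => u v; rewrite fP T'E.
Qed.

Lemma adjointEr H K (T : bop H K) x y : '[x, T y] = '[T^\dag x, y].
Proof. by rewrite hdotC adjointE -hdotC. Qed.

End Projection.

(** * Extension of densely defined bounded operators *)

Section Extension.
Context {C : numClosedFieldType} {H K : hilbertType C}.
Variables (G : H -> K -> Prop) (M : C).
Hypothesis M0 : 0 <= M.
Hypothesis G_lin : forall a x y x' y',
  G x y -> G x' y' -> G (a *: x + x') (a *: y + y').
Hypothesis G_le : forall x y, G x y -> `|y| <= M * `|x|.
Hypothesis G_dense : closure [set x | exists y, G x y] = setT.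

(** The closure of the graph [G] in the product of [H] and [K]. *)
Let P x y := forall e : C, 0 < e ->
  exists x' y', [/\ G x' y', `|x - x'| < e & `|y - y'| < e].

Let P_lin a x y x' y' : P x y -> P x' y' -> P (a *: x + x') (a *: y + y').
Proof.
move=> Pxy Pxy' e e0; have a1 : 0 < `|a| + 1 by rewrite ltr_wpDl.
have [u [v [Guv xu yv]]] := Pxy _ (divr_gt0 e0 a1).
have [u' [v' [Guv' xu' yv']]] := Pxy' _ (divr_gt0 e0 a1).
(* One estimate serves both coordinates: with [t = e / (|a| + 1)] the total error stays below
   [|a| * t + t = e]. *)
have small (V : normedModType C) (p q p' q' : V) :
    `|p - q| < e / (`|a| + 1) -> `|p' - q'| < e / (`|a| + 1) ->
    `|a *: p + p' - (a *: q + q')| < e.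
  move=> pq pq'; rewrite opprD addrACA -scalerBr.
  rewrite (le_lt_trans (ler_normD _ _))// normrZ.
  rewrite (@le_lt_trans _ _ (`|a| * (e / (`|a| + 1)) + `|p' - q'|))//.
    by rewrite lerD2r ler_wpM2l// ltW.
  rewrite [ltRHS](_ : e = `|a| * (e / (`|a| + 1)) + e / (`|a| + 1)).
    by rewrite ltrD2l.
  by field; rewrite gt_eqF.
by exists (a *: u + u'), (a *: v + v'); split; [exact: G_lin|exact: small..].
Qed.

(** Approximating within [t = e / (M + 1)] costs at most [M * t + t = e], so the bound survives
    closure. *)
Let P_le x y : P x y -> `|y| <= M * `|x|.
Proof.
move=> Pxy; apply/ler_addgt0Pr => e e0; have M1 : 0 < M + 1 by rewrite ltr_wpDl.
have [u [v [Guv xu yv]]] := Pxy _ (divr_gt0 e0 M1).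
have -> : y = v + (y - v) by rewrite addrC subrK.
rewrite (le_trans (ler_normD _ _))//.
rewrite (@le_trans _ _ (M * (`|x| + e / (M + 1)) + e / (M + 1)))//.
  apply: lerD; last exact: ltW.
  rewrite (le_trans (G_le Guv))// ler_wpM2l//.
  have -> : u = x - (x - u) by rewrite opprB addrC subrK.
  by rewrite (le_trans (ler_normB _ _))// lerD2l ltW.
rewrite (_ : _ + _ = M * `|x| + e)//.
by field; rewrite gt_eqF.
Qed.

(** The values of [G] over points near [x] form a filter, proper by density and Cauchy by [G_le]. *)
Let P_ex x : exists y, P x y.
Proof.
pose B (e : C) := [set y | exists2 x', G x' y & `|x - x'| < e].
pose F := filter_from [set e : C | 0 < e] B.
have FF : ProperFilter F.
  apply: filter_from_proper; last first.
    move=> e e0.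
    have : closure [set x | exists y, G x y] x by rewrite G_dense.
    move=> /(_ _ (nbhsx_ballx x e e0))[x' [[y Gxy]]].
    by rewrite -ball_normE /= => xx'; exists y, x'.
  apply: filter_from_filter; first by exists 1 => /=.
  move=> e f /= e0 f0.
  have [ef|/ltW fe] := real_leP (gtr0_real e0) (gtr0_real f0).
    exists e => // y [u Gu ue]; split; exists u => //.
    by rewrite (lt_le_trans ue).
  exists f => // y [u Gu ue]; split; exists u => //.
  by rewrite (lt_le_trans ue).
have Fc : cauchy F.
  apply: cauchy_exP => e e0; have M1 : 0 < M + 1 by rewrite ltr_wpDl.
  (* Halving puts any two admissible points within [e / (M + 1)] of each other, so their values
     differ by less than [e]. *)
  have d0 : 0 < e / (M + 1) / 2 by rewrite !divr_gt0.
  have Fd : F (B (e / (M + 1) / 2)) by exists (e / (M + 1) / 2).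
  have [y0 [x0 Gxy0 xx0]] := filter_ex Fd.
  exists y0, (e / (M + 1) / 2) => // y [u Gu xu].
  rewrite -ball_normE /=.
  have := G_lin (-1) Gxy0 Gu; rewrite !scaleN1r => /G_le.
  rewrite distrC [X in `|X|]addrC => /le_lt_trans; apply.
  have : `|- x0 + u| < e / (M + 1).
    rewrite (_ : - x0 + u = x - x0 - (x - u)); last first.
      by rewrite opprB [RHS]addrC addrA subrK addrC.
    rewrite (le_lt_trans (ler_normB _ _))//.
    by rewrite [ltRHS]splitr ltrD.
  rewrite ltr_pdivlMr// => xe; apply: le_lt_trans xe.
  by rewrite mulrC ler_wpM2l// lerDl.
have /cvg_ex[l Fl] : cvg F by exact: cauchy_cvg.
exists l => e e0.
have Fe : F (B e) by exists e.
have [y []] := filter_ex (filterI Fe (Fl _ (nbhsx_ballx l e e0))).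
by rewrite -ball_normE => -[u Gu xu] /= ly; exists u, y.
Qed.

(** [G] is only a relation: the norm bound makes its closure [P] single-valued and density makes it
    total, so [P] is the graph of the extension. *)
Lemma bop_extension : exists T : bop H K, forall x y, G x y -> T x = y.
Proof.
have P_uniq x y y' : P x y -> P x y' -> y = y'.
  move=> Pxy Pxy'; have := P_lin (-1) Pxy' Pxy; rewrite !scaleN1r => /P_le.
  by rewrite addNr normr0 mulr0 normr_le0 addrC subr_eq0 => /eqP.
have [f fP] := choice P_ex.
have flin : linear f.
  by move=> a u v; apply: (P_uniq (a *: u + v)) => //; exact: P_lin.
have fle z : `|f z| <= M * `|z| by exact: P_le.
have [T TE] := bop_intro M0 flin fle.
exists T => x y Gxy; rewrite TE; apply: (P_uniq x); first exact: fP.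
move=> e e0.
by exists x, y; split; rewrite ?subrr ?normr0.
Qed.

End Extension.

(** * Star representations, commutants and the lift *)

Section Representations.
Context {R : realType}.

Lemma rep_mulE (A : cstarType R[i]) (K : hilbertType R[i])
    (sigma : A -> bop K K) : unital_star_rep sigma ->
  forall a b x, sigma (a * b) x = sigma a (sigma b x).
Proof. by move=> [_ _ sM _] a b x; rewrite sM. Qed.

Lemma rep_1E (A : cstarType R[i]) (K : hilbertType R[i])
    (sigma : A -> bop K K) : unital_star_rep sigma ->
  forall x, sigma 1 x = x.
Proof. by move=> [_ s1 _ _] x; rewrite s1. Qed.

Lemma rep_starE (A : cstarType R[i]) (K : hilbertType R[i])
    (sigma : A -> bop K K) : unital_star_rep sigma ->
  forall a x y, '[sigma (star a) x, y] = '[x, sigma a y].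
Proof. by move=> [_ _ _ sS] a x y; rewrite sS -adjointEr. Qed.

Lemma rep_sumE (A : cstarType R[i]) (K : hilbertType R[i])
    (sigma : A -> bop K K) : unital_star_rep sigma ->
  forall I (r : seq I) (F : I -> A) x,
  sigma (\sum_(i <- r) F i) x = \sum_(i <- r) sigma (F i) x.
Proof.
move=> [sl _ _ _] I r F x.
have s0 : sigma 0 = 0.
  by have := sl (-1) 0 0; rewrite scaler0 addr0 scaleN1r addNr.
elim: r => [|i r IHr]; first by rewrite !big_nil s0.
by rewrite !big_cons -[F i]scale1r sl bop_linE scale1r IHr scale1r.
Qed.

(** The witness has [a] as its first row and zeros below; the empty matrix, having no first row, is
    treated apart. *)
Lemma mx_pos_gram (A : cstarType R[i]) n (a : 'I_n -> A) :
  mx_pos (\matrix_(i, j) (star (a i) * a j)).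
Proof.
case: n a => [|n] a; first by exists 0; apply/matrixP => -[].
exists (\matrix_(k, j) if k == 0 then a j else 0).
apply/matrixP => i j; rewrite !mxE big_ord_recl big1 ?addr0 => [|k _].
  by rewrite !mxE.
by rewrite !mxE mulr0.
Qed.

End Representations.

Section Commutant.
Context {R : realType} {B : cstarType R[i]} {K : hilbertType R[i]}.
Variable pi : B -> bop K K.

Lemma commutantE D a x : commutant pi D -> D (pi a x) = pi a (D x).
Proof. by move=> /(_ a)/(congr1 (fun T : bop K K => T x)). Qed.

Lemma commutant_id : commutant pi (bop_id K).
Proof. by move=> a; exact: bop_ext. Qed.

Lemma commutant_lin a D1 D2 : commutant pi D1 -> commutant pi D2 ->
  commutant pi (a *: D1 + D2).
Proof.
move=> D1pi D2pi b; apply: bop_ext => x.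
by rewrite !bop_compE !bop_linE !commutantE// bop_lin.
Qed.

(** The range of [pi] is closed under adjoints: commutation with [star b] dualises to commutation
    with [b]. *)
Lemma commutant_adjoint D : unital_star_rep pi -> commutant pi D ->
  commutant pi D^\dag.
Proof.
move=> pi_rep Dpi b; apply: bop_ext => x; apply: hdot_inj => y.
rewrite !bop_compE -adjointEr -[b]starK !(rep_starE pi_rep) -adjointEr.
by rewrite commutantE.
Qed.

(** Positive elements span the commutant: split into real and imaginary parts, then shift each by a
    multiple of the identity. *)
Lemma commutant_positive_ind (P : bop K K -> Prop) : unital_star_rep pi ->
  (forall D, commutant pi D -> positive_op D -> P D) ->
  (forall a D1 D2, commutant pi D1 -> commutant pi D2 -> P D1 -> P D2 ->
     P (a *: D1 + D2)) ->
  forall D, commutant pi D -> P D.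
Proof.
move=> pi_rep Ppos Plin.
(* A self-adjoint D bounded by M is - M + (M + D) with M + D >= 0. *)
have Psa D : commutant pi D -> (forall x y, '[D x, y] = '[x, D y]) -> P D.
  move=> Dpi Dsa; have [M M0 DM] := bop_bounded D.
  have -> : D = (- M) *: bop_id K + (M *: bop_id K + D).
    by rewrite addrA -scalerDl addNr scale0r add0r.
  have id0 : positive_op (bop_id K) by move=> x; exact: hdot_ge0.
  have idpi := commutant_id.
  apply: Plin => //; [exact: commutant_lin|exact: Ppos|apply: Ppos].
    exact: commutant_lin.
  move=> x; rewrite bop_linE hdotDl hdotZl addrC -lerBlDr sub0r.
  apply: real_lerNnormlW; first by apply/CrealP; rewrite -hdotC -Dsa.
  rewrite (le_trans (hdot_le _ _))// hdot_norm expr2 mulrA ler_wpM2r//.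
move=> D Dpi; have D'pi := commutant_adjoint pi_rep Dpi.
have zpi : commutant pi 0.
  by move=> a; apply: bop_ext => x; rewrite !bop_compE bop0.
have D'l x y : '[D^\dag x, y] = '[x, D y] by rewrite adjointEr.
have D'r x y : '[x, D^\dag y] = '[D x, y] by rewrite adjointE.
(* The real and imaginary parts of [D]. The coefficient 1 and the trailing zeros give the shape that
   [commutant_lin] and [bop_linE] expect. *)
pose D1 := 2^-1 *: (1 *: D + D^\dag) + 0.
pose D2 := (- 'i / 2) *: ((- 1) *: D^\dag + D) + 0.
have -> : D = 'i *: D2 + D1.
  have i2 : 'i * (- 'i / 2) = 2^-1 :> R[i].
    by rewrite mulrA mulrN -expr2 sqrCi opprK mul1r.
  rewrite /D1 /D2 !addr0 scalerA i2 scaleN1r scale1r -scalerDr [- _ + D]addrC.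
  rewrite addrACA addNr addr0 -mulr2n -[D *+ 2]scaler_nat scalerA.
  by rewrite mulVf ?scale1r ?pnatr_eq0.
have D1pi : commutant pi D1 by apply: commutant_lin => //; exact: commutant_lin.
have D2pi : commutant pi D2 by apply: commutant_lin => //; exact: commutant_lin.
apply: Plin => //; apply: Psa => // x y.
  rewrite !bop_linE !addr0 !hdotZl !hdotZr !hdotDl !hdotDr !hdotZl !hdotZr.
  rewrite D'l D'r rmorphM fmorphV !rmorphN rmorph1 /= conjCi conjC_nat opprK.
  by ring.
rewrite !bop_linE !addr0 !hdotZl !hdotZr !hdotDl !hdotDr !hdotZl !hdotZr.
by rewrite D'l D'r fmorphV rmorph1 /= conjC_nat; ring.
Qed.

End Commutant.

(** * The lift of the commutant of [pi] *)

Section Lift.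
Context {R : realType}.
Context {A B : cstarType R[i]} {K L : hilbertType R[i]}.
Variables (Lambda : A -> B) (pi : B -> bop K K) (phi : A -> bop L L).
Variable (S : bop K L).
Hypothesis Lambda_cp : completely_positive Lambda.
Hypothesis pi_rep : unital_star_rep pi.
Hypothesis phi_stinespring : minimal_stinespring (pi \o Lambda) phi S.

Let phi_rep : unital_star_rep phi.
Proof. by have [[]] := phi_stinespring. Qed.

(** Complete positivity of [Lambda] enters through this identity. The vectors [z] are fixed before
    [D1] and [D2], so different pairs can be compared term by term. *)
Lemma gram_diagonal (s : seq (A * K)) :
  exists n (z : 'I_n -> K), forall D1 D2, commutant pi D1 -> commutant pi D2 ->
    '[\sum_(p <- s) phi p.1 (S (D1 p.2)), \sum_(p <- s) phi p.1 (S (D2 p.2))] =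
    \sum_k '[D1 (z k), D2 (z k)].
Proof.
pose t := tnth (in_tuple s).
have [c cP] := proj2 Lambda_cp _ _ (mx_pos_gram (fun i => (t i).1)).
exists (size s), (fun k => \sum_j pi (c k j) (t j).2) => D1 D2 D1pi D2pi.
rewrite [X in '[X, _]]big_tnth [X in '[_, X]]big_tnth hdot_suml.
transitivity (\sum_j \sum_i \sum_k
    '[pi (c k j) (D1 (t j).2), pi (c k i) (D2 (t i).2)]).
  apply: eq_bigr => j _; rewrite hdot_sumr; apply: eq_bigr => i _.
  (* Both [phi] factors move to the left slot, where the Stinespring identity turns
     [S^\dag \bo phi _ \bo S] into [pi (Lambda _)]. *)
  rewrite -(rep_starE phi_rep) -(rep_mulE phi_rep) adjointEr.
  have [[_ /(_ (star (t i).1 * (t j).1)) e] _] := phi_stinespring.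
  have := congr1 (fun T : bop K K => T (D1 (t j).2)) e.
  rewrite /= => <-.
  have /matrixP/(_ i j) := cP; rewrite !mxE => ->.
  rewrite (rep_sumE pi_rep) hdot_suml; apply: eq_bigr => k _.
  by rewrite !mxE (rep_mulE pi_rep) (rep_starE pi_rep).
rewrite exchange_big /=; under eq_bigr do rewrite exchange_big /=.
rewrite exchange_big /=; apply: eq_bigr => k _.
rewrite !bop_sum hdot_suml exchange_big; apply: eq_bigr => j _ /=.
by rewrite hdot_sumr; apply: eq_bigr => i _; rewrite !commutantE.
Qed.

(** Minimality, with the scalars of a linear combination absorbed into the vectors of [K]. *)
Let rep_span_dense :
  closure [set x | exists s : seq (A * K), x = \sum_(p <- s) phi p.1 (S p.2)] =
  setT.
Proof.
apply/seteqP; split=> // x _.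
have [_ /seteqP[_ /(_ x I)]] := phi_stinespring.
apply: closure_subset => {x} _ [s sX ->].
elim: s sX => [|p s IHs] sX; first by exists [::]; rewrite !big_nil.
have [|t tE] := IHs; first by move=> q qs; apply: sX; rewrite inE qs orbT.
have [|a [eta pE]] := sX p; first by rewrite inE eqxx.
by exists ((a, p.1 *: eta) :: t); rewrite !big_cons tE pE !bopZ.
Qed.

(** Validates the [xget] in [Gamma_lift]. A vector may be such a sum in many ways, so the
    prescription is kept as a relation [G]; its norm bound settles well-definedness through
    [bop_extension]. *)
Lemma Gamma_liftP (D : bop K K) : commutant pi D ->
  commutant phi (Gamma_lift phi S D) /\
  forall a eta, Gamma_lift phi S D (phi a (S eta)) = phi a (S (D eta)).
Proof.
move=> Dpi; suff /(xgetPex 0) : exists G : bop L L, commutant phi G /\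
    forall a eta, G (phi a (S eta)) = phi a (S (D eta)) by [].
have idpi := @commutant_id _ _ _ pi.
have [M M0 DM] := bop_bounded D.
pose G (x y : L) := exists2 s : seq (A * K),
  x = \sum_(p <- s) phi p.1 (S p.2) & y = \sum_(p <- s) phi p.1 (S (D p.2)).
have Glin a x y x' y' : G x y -> G x' y' -> G (a *: x + x') (a *: y + y').
  move=> [s -> ->] [s' -> ->]; exists ([seq (p.1, a *: p.2) | p <- s] ++ s');
  by rewrite big_cat big_map scaler_sumr; congr (_ + _); apply: eq_bigr => p _;
     rewrite !bopZ.
have Gle x y : G x y -> `|y| <= M * `|x|.
  move=> [s -> ->]; have [n [z zP]] := gram_diagonal s.
  rewrite -(@ler_pXn2r _ 2) ?nnegrE ?mulr_ge0 ?(ltW M0)// exprMn -!hdot_norm.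
  rewrite (zP _ _ Dpi Dpi).
  have -> : '[\sum_(p <- s) phi p.1 (S p.2), \sum_(p <- s) phi p.1 (S p.2)] =
    \sum_k '[z k, z k] by exact: (zP _ _ idpi idpi).
  rewrite mulr_sumr ler_sum// => k _.
  by rewrite !hdot_norm -exprMn lerXn2r ?nnegrE ?mulr_ge0 ?(ltW M0).
have phiS a eta : G (phi a (S eta)) (phi a (S (D eta))).
  by exists [:: (a, eta)]; rewrite big_seq1.
have Gdense : closure [set x | exists y, G x y] = setT.
  rewrite -rep_span_dense; congr closure.
  apply/seteqP; split=> [x [y [s -> _]]|].
    by exists s.
  by move=> _ [s ->]; exists (\sum_(p <- s) phi p.1 (S (D p.2))), s.
have [T TG] := bop_extension (ltW M0) Glin Gle Gdense.
exists T; split=> [b|a eta]; last exact: TG.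
apply: bop_ext => x; have [_ /seteqP[_ /(_ x I)]] := phi_stinespring.
apply: bop_eq_span => _ [a [eta ->]] /=.
by rewrite -(rep_mulE phi_rep) !(TG _ _ (phiS _ _)) (rep_mulE phi_rep).
Qed.

Lemma Gamma_lift_lin a (D1 D2 : bop K K) : commutant pi D1 -> commutant pi D2 ->
  Gamma_lift phi S (a *: D1 + D2) =
  a *: Gamma_lift phi S D1 + Gamma_lift phi S D2.
Proof.
move=> D1pi D2pi; have [_ G1] := Gamma_liftP D1pi.
have [_ G2] := Gamma_liftP D2pi.
have [|_ G12] := Gamma_liftP (_ : commutant pi (a *: D1 + D2)).
  exact: commutant_lin.
apply: bop_ext => x; have [_ /seteqP[_ /(_ x I)]] := phi_stinespring.
apply: bop_eq_span => _ [b [eta ->]].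
by rewrite bop_linE G12 G1 G2 bop_linE !bop_lin.
Qed.

Lemma Gamma_lift_positive (D : bop K K) : commutant pi D ->
  positive_op D -> positive_op (Gamma_lift phi S D).
Proof.
move=> Dpi D0; have [_ GD] := Gamma_liftP Dpi.
have idpi := @commutant_id _ _ _ pi.
pose X : set L :=
  [set x | exists s : seq (A * K), x = \sum_(p <- s) phi p.1 (S p.2)].
apply: (@positive_op_dense _ _ _ X); last first.
  move=> _ [s ->]; have [n [z zP]] := gram_diagonal s.
  rewrite bop_sum; under eq_bigr do rewrite GD.
  have -> : '[\sum_(p <- s) phi p.1 (S (D p.2)),
              \sum_(p <- s) phi p.1 (S p.2)] =
    \sum_k '[D (z k), z k] by exact: (zP _ _ Dpi idpi).
  by rewrite sumr_ge0// => k _; exact: D0.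
exact: rep_span_dense.
Qed.

End Lift.

(** * Compressions and the transfer map *)

Section Subspaces.
Context {R : realType} {L : hilbertType R[i]}.
Implicit Types (M : closedSubspace L) (X : set L).

Lemma hdot_val M (x y : sub_hilbert M) : '[x, y] = '[val x, val y].
Proof. by []. Qed.

Lemma norm_val M (x : sub_hilbert M) : `|x| = `|val x|.
Proof. by []. Qed.

Lemma valD M (a : R[i]) (x y : sub_hilbert M) :
  val (a *: x + y) = a *: val x + val y.
Proof. exact: linearP. Qed.

Lemma sub_hilbert_mem M (x : sub_hilbert M) : subspace_set M (val x).
Proof. exact/set_mem/sub_hilbertP. Qed.

Lemma corestrict_opE (H : hilbertType R[i]) M (T : bop H L) :
  (forall x, subspace_set M (T x)) ->
  forall x, val (corestrict_op M T x) = T x.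
Proof.
move=> MT; suff /(xgetPex 0) : exists T' : bop H (sub_hilbert M),
    forall x, val (T' x) = T x by [].
have [N N0 TN] := bop_bounded T.
pose f x := SubHilbert (mem_set (MT x)).
have flin : linear f.
  by move=> a x y; apply: val_inj; rewrite valD /= bop_lin.
have [T' T'E] := bop_intro (ltW N0) flin TN.
by exists T' => x; rewrite T'E.
Qed.

(** Makes a restriction the corestriction of [T] composed with the inclusion. *)
Lemma incl_exists M : exists J : bop (sub_hilbert M) L, J =1 val.
Proof.
by apply: (bop_intro ler01 (valD (M := M))) => x; rewrite mul1r -norm_val.
Qed.

Lemma restrict_opE M (T : bop L L) :
  (forall x, subspace_set M x -> subspace_set M (T x)) ->
  forall x, val (restrict_op M T x) = T (val x).
Proof.
move=> MT; suff /(xgetPex 0) : exists T' : bop (sub_hilbert M) (sub_hilbert M),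
    forall x, val (T' x) = T (val x) by [].
have [J JE] := incl_exists M; exists (corestrict_op M (T \bo J)) => x.
rewrite corestrict_opE => [|y]; first by rewrite /= JE.
by rewrite /= JE; apply/MT/sub_hilbert_mem.
Qed.

Lemma closed_span_sub X x : X x -> subspace_set (closed_span X) x.
Proof.
move=> Xx; apply: subset_closure; exists [:: (1, x)].
  by move=> p; rewrite inE => /eqP ->.
by rewrite big_seq1 scale1r.
Qed.

Lemma closed_span_map X M (T : bop L L) :
  (forall x, X x -> subspace_set M (T x)) ->
  forall x, subspace_set (closed_span X) x -> subspace_set M (T x).
Proof.
move=> XM; apply: (@closure_sub_closed _ _ (T @^-1` M)); last first.
  apply: preimage_closed; last exact: subspace_closed.
  by move=> x _; exact: bop_continuous.
move=> _ [s sX ->] /=; rewrite bop_sum.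
elim: s sX => [|p s IHs] sX; first by rewrite big_nil; exact: subspace0.
rewrite big_cons bopZ; apply: subspace_lin.
  by apply/XM/sX; rewrite inE eqxx.
by apply: IHs => q qs; apply: sX; rewrite inE qs orbT.
Qed.

Lemma closed_span_orth X y : (forall x, X x -> '[x, y] = 0) ->
  forall x, subspace_set (closed_span X) x -> '[x, y] = 0.
Proof.
move=> Xy; apply: (@closure_sub_closed _ _ [set x | '[x, y] = 0]); last first.
  apply: (@preimage_closed L R[i]^o (fun x => '[x, y]) [set 0]).
    by move=> u _; exact: (@hdotr_continuous _ _ _ (bop_id L) y u).
  exact/accessible_closed_set1/hausdorff_accessible/norm_hausdorff.
move=> _ [s sX ->] /=; rewrite hdot_suml big_seq big1// => p ps.
by rewrite hdotZl Xy ?mulr0//; exact: sX.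
Qed.

(** The projection is applied on the left only, since the argument already lies in [M]. *)
Definition compression M (T : bop L L) : bop (sub_hilbert M) (sub_hilbert M) :=
  restrict_op M (orth_proj M \bo T).

Lemma compressionE M (T : bop L L) x :
  val (compression M T x) = orth_proj M (T (val x)).
Proof.
by rewrite restrict_opE// => y _; have [] := orth_projP M (T y).
Qed.

Lemma compression_positive M (T : bop L L) :
  positive_op T -> positive_op (compression M T).
Proof.
move=> T0 x; rewrite hdot_val compressionE hdot_orth_proj; first exact: T0.
exact: sub_hilbert_mem.
Qed.

Lemma compression_lin M a (S T : bop L L) :
  compression M (a *: S + T) = a *: compression M S + compression M T.
Proof.
apply: bop_ext => x; apply: val_inj.
by rewrite bop_linE valD !compressionE bop_linE bop_lin.
Qed.

End Subspaces.

(** * The Radon-Nikodym derivative and the transfer map *)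

Section Transfer.
Context {R : realType} {A B : cstarType R[i]} {H K L : hilbertType R[i]}.
Variable Lambda : A -> B.
Hypothesis Lambda_cp : completely_positive Lambda.
Variables (pi : B -> bop K K) (V : bop H K).
Hypothesis pi_rep : unital_star_rep pi.
Variables (phi : A -> bop L L) (S : bop K L).
Hypothesis phi_stinespring : minimal_stinespring (pi \o Lambda) phi S.

Let phi_rep : unital_star_rep phi.
Proof. by have [[]] := phi_stinespring. Qed.

Local Notation M := (K_OL V phi S).
Local Notation Q := (Q_OL V phi S).
Local Notation rho := (rho V phi S).
Local Notation W := (W_OL V phi S).
Local Notation Gamma := (Gamma_lift phi S).

Lemma K_OL_mem a xi : subspace_set M (phi a (S (V xi))).
Proof. by apply: closed_span_sub; exists a, xi. Qed.

Lemma K_OL_mem1 xi : subspace_set M (S (V xi)).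
Proof. by rewrite -(rep_1E phi_rep (S _)); exact: K_OL_mem. Qed.

Lemma K_OL_stable a x : subspace_set M x -> subspace_set M (phi a x).
Proof.
apply: closed_span_map => _ [b [xi ->]].
by rewrite -(rep_mulE phi_rep); exact: K_OL_mem.
Qed.

(** [K_OL] is invariant under [phi a] and [phi (star a)], so [phi a] also preserves its orthogonal
    complement. *)
Lemma Q_OL_comm a x : Q (phi a x) = phi a (Q x).
Proof.
have [MQ QP] := orth_projP M x.
apply: orth_proj_eq => [|y My]; first exact: K_OL_stable.
rewrite -bopB -[a]starK (rep_starE phi_rep) QP//.
exact: K_OL_stable.
Qed.

Lemma rhoE a x : val (rho a x) = phi a (val x).
Proof. by rewrite restrict_opE// => y; exact: K_OL_stable. Qed.

Lemma W_OLE xi : val (W xi) = S (V xi).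
Proof. by rewrite corestrict_opE// => y; exact: K_OL_mem1. Qed.

(** Minimality of [(rho, W)], in the form used to test vectors for zero. *)
Lemma K_OL_orth (u : sub_hilbert M) :
  (forall a xi, '[rho a (W xi), u] = 0) -> u = 0.
Proof.
move=> uP; apply: hdot_eq0; rewrite hdot_val.
apply: (closed_span_orth _ (sub_hilbert_mem u)) => _ [a [xi ->]].
by rewrite -W_OLE -rhoE; exact: uP.
Qed.

Lemma rho_rep_starE a (x y : sub_hilbert M) :
  '[rho (star a) x, y] = '[x, rho a y].
Proof. by rewrite !hdot_val !rhoE (rep_starE phi_rep). Qed.

Lemma rho_mulE a b x : rho (a * b) x = rho a (rho b x).
Proof. by apply: val_inj; rewrite !rhoE (rep_mulE phi_rep). Qed.

(** For [E] commuting with [rho], the form of [E] on generators [rho b (W eta)] and [rho a (W xi)]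
    depends only on the dilation at [star a * b], and generators are total. *)
Lemma radon_nikodym_uniq (E F : bop (sub_hilbert M) (sub_hilbert M)) :
  commutant rho E -> commutant rho F ->
  (forall a, W^\dag \bo rho a \bo E \bo W = W^\dag \bo rho a \bo F \bo W) ->
  E = F.
Proof.
move=> Erho Frho EF; apply: bop_ext => x; apply/eqP; rewrite -subr_eq0.
apply/eqP/K_OL_orth => a xi; set y := rho a (W xi).
(* [K_OL_orth] tests one slot at a time; passing to adjoints allows the other slot to be tested in
   turn. *)
suff Ey : E^\dag y - F^\dag y = 0.
  by rewrite hdotBr !(@adjointEr _ _ _ _ y) -hdotBl Ey hdot0l.
apply: K_OL_orth => b eta; rewrite hdotBr -!adjointE !commutantE//.
rewrite /y -!rho_rep_starE -!rho_mulE !adjointEr.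
have := congr1 (fun T : bop H H => T eta) (EF (star a * b)).
by rewrite !bop_compE => ->; rewrite subrr.
Qed.

Lemma compression_Gamma_commutant D : commutant pi D ->
  commutant rho (compression M (Gamma D)).
Proof.
move=> Dpi a; apply: bop_ext => x; apply: val_inj.
have [Gphi _] := Gamma_liftP Lambda_cp pi_rep phi_stinespring Dpi.
by rewrite !bop_compE rhoE !compressionE rhoE commutantE// -Q_OL_comm.
Qed.

(** [Q] disappears against vectors of [K_OL], the lift turns [S (V xi)] into [S (D (V xi))], and the
    Stinespring identity for [phi] restores [pi (Lambda a)]. *)
Lemma compression_Gamma_dilates D : commutant pi D ->
  forall a, (Omega_ pi V D \o Lambda) a =
            W^\dag \bo rho a \bo compression M (Gamma D) \bo W.
Proof.
move=> Dpi a; apply: bop_ext => xi; apply: hdot_inj => eta.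
have [_ GD] := Gamma_liftP Lambda_cp pi_rep phi_stinespring Dpi.
rewrite [(_ \o _) a]/= /Omega_ !bop_compE -!adjointEr.
rewrite hdot_val rhoE compressionE !W_OLE.
rewrite -Q_OL_comm hdot_orth_proj; last exact: K_OL_mem1.
(* Inserting [phi 1] puts the vector in the form on which the lift is prescribed. *)
rewrite -(rep_1E phi_rep (S (V xi))) GD (rep_1E phi_rep).
have [[_ /(_ a) e] _] := phi_stinespring.
have /= -> := congr1 (fun T : bop K K => T (D (V xi))) e.
by rewrite -adjointEr.
Qed.

(** The compression meets the three defining conditions and is the only operator to do so, hence is
    the one picked by [xget]. *)
Lemma radon_nikodymE D : commutant pi D -> positive_op D ->
  radon_nikodym rho W (Omega_ pi V D \o Lambda) = compression M (Gamma D).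
Proof.
move=> Dpi D0; apply: xget_unique.
  split; last exact: compression_Gamma_dilates.
    apply: compression_positive.
    exact: (Gamma_lift_positive Lambda_cp pi_rep phi_stinespring).
  exact: compression_Gamma_commutant.
move=> E [_ Erho EP]; apply: radon_nikodym_uniq => //.
  exact: compression_Gamma_commutant.
by move=> a; rewrite -EP compression_Gamma_dilates.
Qed.

(** The compressed lift is itself a linear extension of the derivative, so the specification of
    [transfer] is met; positive elements then determine its value on the commutant. *)
Lemma transferE D : commutant pi D ->
  transfer Lambda pi V phi S D = compression M (Gamma D).
Proof.
pose T := transfer Lambda pi V phi S; rewrite -/T; move: D.
pose spec (T : bop K K -> bop (sub_hilbert M) (sub_hilbert M)) :=
  (forall a D1 D2, commutant pi D1 -> commutant pi D2 ->
     T (a *: D1 + D2) = a *: T D1 + T D2) /\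
  (forall D, commutant pi D -> positive_op D ->
     T D = radon_nikodym rho W (Omega_ pi V D \o Lambda)).
have [Tlin Tpos] : spec T.
  apply: (@xgetPex _ (fun=> 0) spec); exists (fun D => compression M (Gamma D)).
  split=> [a D1 D2 D1pi D2pi|D Dpi D0]; last by rewrite radon_nikodymE.
  rewrite (Gamma_lift_lin Lambda_cp pi_rep phi_stinespring)//.
  exact: compression_lin.
apply: commutant_positive_ind => // [D Dpi D0|a D1 D2 D1pi D2pi T1 T2].
  by rewrite Tpos// radon_nikodymE.
rewrite Tlin// T1 T2 -compression_lin.
by rewrite (Gamma_lift_lin Lambda_cp pi_rep phi_stinespring).
Qed.

End Transfer.

Local Close Scope classical_set_scope.

Theorem theorem3p4 (R : realType) (A B : cstarType R[i])
    (H K L : hilbertType R[i])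
    (Omega : B -> bop H H) (Lambda : A -> B)
    (Omega_cp : completely_positive_op Omega)
    (Lambda_cp : completely_positive Lambda)
    (pi : B -> bop K K) (V : bop H K)
    (pi_stinespring : minimal_stinespring Omega pi V)
    (phi : A -> bop L L) (S : bop K L)
    (phi_stinespring : minimal_stinespring (pi \o Lambda) phi S)
    (D : bop K K) (D_commutant : commutant pi D)
    (x : sub_hilbert (K_OL V phi S)) :
  val (transfer Lambda pi V phi S D x) =
  Q_OL V phi S (Gamma_lift phi S D (Q_OL V phi S (val x))).
Proof.
have [[pi_rep _] _] := pi_stinespring.
rewrite (transferE Lambda_cp V pi_rep phi_stinespring D_commutant) compressionE.
(* The inner projection fixes [val x], which reconciles the one-sided compression with the two-sided
   formula. *)
by rewrite [Q_OL _ _ _ (val x)]orth_proj_id//; exact: sub_hilbert_mem.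
Qed.
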